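(* Let $k\ge 3$. For $r\ge 1$, let $k_r(\lambda)$ be the characteristic polynomial of the $r\times r$ matrix $K_r$ whose $(p,q)$ entry is $\binom{k-2+q-p}{k-3}$ if $q\ge p$, $1$ if $q=p-1$, and $0$ if $q<p-1$; and let $k_0(\lambda)=1$. Then for all $r\ge 1$, $$k_{r}(\lambda) = \left(\binom{k-2}{k-3}-\lambda\right)k_{r-1}(\lambda) + \sum_{i=2}^{r}(-1)^{i+1}\binom{k+i-3}{k-3}k_{r-i}(\lambda).$$
   Context: The characteristic polynomial of an $r\times r$ matrix $K_r$ is $\det(K_r-\lambda I)$. Empty sums are $0$. *)

(* Defs.v *)
From HB Require Import structures.
From mathcomp Require Import all_boot all_order all_algebra.

Set Implicit Arguments.
Unset Strict Implicit.
Unset Printing Implicit Defensive.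

Import GRing.Theory.
Local Open Scope ring_scope.

(* Indices p, q range over 'I_r, hence start at 0 instead of 1; the entries
   depend only on q - p.  For p <= q and 3 <= k no subtraction truncates. *)
Definition Kmx (k r : nat) : 'M[int]_r :=
  \matrix_(p < r, q < r)
    if (p <= q)%N then 'C(k - 2 + q - p, k - 3)%:Z
    else if (p == q.+1 :> nat) then 1
    else 0.

(* Sign convention det (A - lambda I); MathComp's char_poly is
   det (lambda I - A), i.e. it differs by the factor (-1) ^+ r. *)
Definition charpoly_det (R : comNzRingType) (r : nat) (A : 'M[R]_r) : {poly R} :=
  \det (map_mx polyC A - 'X%:M).

Definition kpoly (k r : nat) : {poly int} :=
  if r is 0 then 1 else charpoly_det (Kmx k r).

(* Main.v *)
Require Import Defs.
From HB Require Import structures.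
From mathcomp Require Import all_boot all_order all_algebra.
From mathcomp Require Import zify.

Set Implicit Arguments.
Unset Strict Implicit.
Unset Printing Implicit Defensive.

Import GRing.Theory.
Local Open Scope ring_scope.

(** [charpoly_det (Kmx k r)] is the determinant of a Toeplitz Hessenberg matrix
with subdiagonal 1, and the recurrence is its expansion along the first row.
Letting that first row [b] be arbitrary turns this into an induction:
expanding along the first column gives two minors, one Toeplitz and one of the
same shape with [b] shifted by one. *)

Definition hess_entry (R : pzRingType) (a : nat -> R) (p q : nat) : R :=
  if (p <= q)%N then a (q - p)%N else (p == q.+1)%:R.

Definition toeplitz_hess (R : pzRingType) (a : nat -> R) (n : nat) : 'M[R]_n :=
  \matrix_(p < n, q < n) hess_entry a p q.

Definition row_hess (R : pzRingType) (a b : nat -> R) (n : nat) : 'M[R]_n :=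
  \matrix_(p < n, q < n) if p == 0%N :> nat then b q else hess_entry a p q.

Lemma det_row_hess_rec (R : comPzRingType) (a b : nat -> R) (n : nat) :
  \det (row_hess a b n.+2) =
    b 0%N * \det (toeplitz_hess a n.+1) - \det (row_hess a (b \o S) n.+1).
Proof.
(* Below row 1, column 0 vanishes. *)
rewrite (expand_det_col _ ord0) !big_ord_recl big1 => [|i _]; last first.
  by rewrite mxE /= /hess_entry /= mul0r.
rewrite addr0 /cofactor !mxE /= expr0 expr1 mul1r mulN1r mul1r.
congr (_ * _ - _); congr (\det _); apply/matrixP=> p q; rewrite !mxE //=.
(* In the minor without row 1, row 0 is [b] shifted, while a later row and its column both lose one
   from their index, so [q - p] is kept. *)
by case: p => [[|p] hp].
Qed.

Lemma det_row_hess (R : comPzRingType) (a b : nat -> R) (n : nat) :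
  \det (row_hess a b n.+1) =
    \sum_(j < n.+1) (-1) ^+ j * b j * \det (toeplitz_hess a (n - j)).
Proof.
elim: n b => [|n IHn] b.
  by rewrite det_mx11 big_ord1 mxE /= expr0 mul1r det_mx00 mulr1.
rewrite det_row_hess_rec IHn [RHS]big_ord_recl expr0 mul1r subn0 -sumrN.
by congr (_ + _); apply: eq_bigr => j _; rewrite /= exprS mulN1r !mulNr.
Qed.

(** The first row of the Toeplitz matrix is [a] itself, so this is the case [b = a]. *)
Lemma det_toeplitz_hess (R : comPzRingType) (a : nat -> R) (n : nat) :
  \det (toeplitz_hess a n.+1) =
    \sum_(j < n.+1) (-1) ^+ j * a j * \det (toeplitz_hess a (n - j)).
Proof.
rewrite -det_row_hess; congr (\det _); apply/matrixP=> p q; rewrite !mxE.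
by case: eqP => // ->; rewrite /hess_entry subn0.
Qed.

(** Subtracting ['X] on the diagonal keeps the matrix Toeplitz, as it only changes the symbol at 0.
    For [r = 0] the empty determinant is 1. *)
Lemma kpoly_toeplitz_hess (k r : nat) :
  kpoly k r =
    \det (toeplitz_hess
      (fun j => 'C(k - 2 + j, k - 3)%:R - 'X *+ (j == 0%N)) r).
Proof.
case: r => [|r]; first by rewrite det_mx00.
congr (\det _); apply/matrixP=> p q; rewrite !mxE /hess_entry -val_eqE /=.
case: leqP => [le_pq|lt_qp].
  by rewrite addnBA // subn_eq0 eqn_leq le_pq -natz polyC_natr.
by rewrite [p == q :> nat]gtn_eqF // subr0; case: eqP.
Qed.

Theorem corollary1 (k : nat) (hk : (3 <= k)%N) (r : nat) (hr : (1 <= r)%N) :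
  kpoly k r =
    ('C(k - 2, k - 3)%:R - 'X) * kpoly k (r - 1)
    + \sum_(2 <= i < r.+1)
        (-1) ^+ (i + 1) * 'C(k + i - 3, k - 3)%:R * kpoly k (r - i).
Proof.
case: r hr => // n _.
rewrite kpoly_toeplitz_hess det_toeplitz_hess big_ord_recl.
rewrite expr0 mul1r addn0 subn0 subn1 -kpoly_toeplitz_hess; congr (_ + _).
(* Column [j] of the expansion is the summand of index [j + 1] in the statement; the signs agree
   because the exponents [j] and [j + 2] have the same parity. *)
rewrite big_add1 big_add1 big_mkord; apply: eq_bigr => i _.
rewrite -kpoly_toeplitz_hess subr0 /= /bump /= add1n addn1 !exprS !mulN1r opprK.
by congr (_ * 'C(_, _)%:R * _); lia.
Qed.
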